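(* Let $(\iota_1,\iota_2)$ be a commensuration between profinite groups $G_1$ and $G_2$ with trivial virtual center over a profinite group $H$. Then $(\iota_1,\iota_2)$ admits a completion (in the category of profinite groups) if and only if the subgroup $\langle\eta_1(G_1),\eta_2(G_2)\rangle$ of $\operatorname{Comm}(H)$ is precompact.
   Context: A commensuration between profinite groups $G_1,G_2$ over a profinite group $H$ is a pair $(\iota_1,\iota_2)$ of continuous monomorphisms $\iota_i:H\to G_i$ with open images, $i=1,2$. A completion is a pair $(j_1,j_2)$ of continuous monomorphisms $j_i:G_i\to K$ with open images into a common profinite group $K$ such that $j_1\circ\iota_1=j_2\circ\iota_2$. The virtual center $\operatorname{VZ}(G)$ of a profinite group $G$ is the subgroup of elements whose centralizer is open in $G$. A virtual automorphism of a profinite group $H$ is a continuous isomorphism between two open subgroups of $H$; two are equivalent if they coincide on some open subgroup. The equivalence classes form a group, the commensurator $\operatorname{Comm}(H)$. For $U$ open in $H$, conjugation gives a homomorphism $\iota_U:U\to\operatorname{Comm}(H)$; $\operatorname{Comm}(H)$ carries the strong topology, in which the subgroups $\operatorname{Im}(\iota_U)$, for $U$ open in $H$, form a basis of open neighborhoods of $1$. When $\operatorname{VZ}(H)=1$ (which holds if $\operatorname{VZ}(G_1)=\operatorname{VZ}(G_2)=1$), $\operatorname{Comm}(H)$ is a locally compact totally disconnected group containing $H$ as an open subgroup. The homomorphism $\eta_i:G_i\to\operatorname{Comm}(H)$ sends $g$ to the class of the virtual automorphism of $H$ obtained by transporting conjugation by $g$ (on a sufficiently small open subgroup of $\iota_i(H)$)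 through $\iota_i$; it is the unique homomorphism with $\eta_i\circ\iota_i=\iota_H$. A subset is precompact if its closure is compact. *)

(* Defs.v *)
From HB Require Import structures.
From mathcomp Require Import all_boot.
From mathcomp Require Import all_classical topology.

Set Implicit Arguments.
Unset Strict Implicit.
Unset Printing Implicit Defensive.

Local Open Scope classical_set_scope.
Local Open Scope quotient_scope.
Local Open Scope group_scope.

HB.mixin Record isTopologicalGroup G of Group G & Topological G := {
  mulg_continuous : continuous (fun xy : G * G => xy.1 * xy.2);
  invg_continuous : continuous (fun x : G => x^-1)
}.

#[short(type="topologicalGroupType")]
HB.structure Definition TopologicalGroup :=
  {G of Group G & Topological G & isTopologicalGroup G}.

HB.mixin Record isProfinite G of TopologicalGroup G := {
  profinite_compact : compact [set: G];
  profinite_hausdorff : hausdorff_space G;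
  profinite_disconnected : totally_disconnected [set: G]
}.

#[short(type="profiniteGroupType")]
HB.structure Definition ProfiniteGroup :=
  {G of TopologicalGroup G & isProfinite G}.

Definition is_subgroup (G : groupType) (A : set G) :=
  [/\ A 1, forall x y, A x -> A y -> A (x * y) & forall x, A x -> A x^-1].

Definition generated (G : groupType) (A : set G) : set G :=
  smallest (@is_subgroup G) A.

Definition open_subgroup (G : topologicalGroupType) (U : set G) :=
  open U /\ is_subgroup U.

Definition centralizer1 (G : groupType) (g : G) : set G :=
  [set h | h * g = g * h].

Definition virtual_center (G : topologicalGroupType) : set G :=
  [set g | open (centralizer1 g)].
Arguments virtual_center : clear implicits.

Record open_mono (H G : profiniteGroupType) := OpenMono {
  open_mono_fun :> H -> G;
  open_monoM : {morph open_mono_fun : x y / x * y};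
  open_mono_continuous : continuous open_mono_fun;
  open_mono_inj : injective open_mono_fun;
  open_mono_open : open (range open_mono_fun)
}.

Record commensuration (G1 G2 H : profiniteGroupType) := Commensuration {
  iota1 : open_mono H G1;
  iota2 : open_mono H G2
}.

Record completion (G1 G2 H : profiniteGroupType)
    (c : commensuration G1 G2 H) := Completion {
  completion_group : profiniteGroupType;
  j1 : open_mono G1 completion_group;
  j2 : open_mono G2 completion_group;
  completionE : j1 \o iota1 c = j2 \o iota2 c
}.

Definition admits_completion (G1 G2 H : profiniteGroupType)
    (c : commensuration G1 G2 H) : Prop := inhabited (completion c).

(* A virtual automorphism is encoded as a total function; only its values on
   the domain are constrained, and its codomain is the image of the domain. *)
Record virtual_aut (H : profiniteGroupType) := VirtualAut {
  va_fun :> H -> H;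
  va_dom : set H;
  va_dom_os : open_subgroup va_dom;
  va_cod_os : open_subgroup (va_fun @` va_dom);
  va_continuous : {within va_dom, continuous va_fun};
  va_inj : set_inj va_dom va_fun;
  vaM : forall x y, va_dom x -> va_dom y ->
    va_fun (x * y) = va_fun x * va_fun y
}.

HB.instance Definition _ (H : profiniteGroupType) :=
  gen_eqMixin (virtual_aut H).
HB.instance Definition _ (H : profiniteGroupType) :=
  gen_choiceMixin (virtual_aut H).

Definition va_equiv (H : profiniteGroupType) (a b : virtual_aut H) : Prop :=
  exists U, [/\ open_subgroup U, U `<=` va_dom a `&` va_dom b
    & forall x, U x -> a x = b x].

Section OpenSubgroups.
Variable G : topologicalGroupType.
Implicit Types (U V : set G) (g x y : G).

Lemma mulgl_continuous g : continuous (fun x : G => g * x).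
Proof.
move=> x; apply: (@continuous2_cvg _ G G G _ _ (fun _ => g) id mul g x).
- exact: (@mulg_continuous G (g, x)).
- exact: cvg_cst.
- exact: cvg_id.
Qed.

Lemma mulgr_continuous g : continuous (fun x : G => x * g).
Proof.
move=> x; apply: (@continuous2_cvg _ G G G _ _ id (fun _ => g) mul x g).
- exact: (@mulg_continuous G (x, g)).
- exact: cvg_id.
- exact: cvg_cst.
Qed.

Lemma conj_continuous g : continuous (fun x : G => g * x * g^-1).
Proof.
move=> x; apply: (@continuous_comp _ _ _ (fun x => g * x) (fun x => x * g^-1)).
  exact: mulgl_continuous.
exact: mulgr_continuous.
Qed.

Lemma open_subgroupT : open_subgroup [set: G].
Proof. by split; [exact: openT|split]. Qed.

Lemma open_subgroupI U V :
  open_subgroup U -> open_subgroup V -> open_subgroup (U `&` V).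
Proof.
move=> [oU [U1 UM UV]] [oV [V1 VM VV]]; split; first exact: openI.
split; first by split.
  by move=> x y [Ux Vx] [Uy Vy]; split; [exact: UM|exact: VM].
by move=> x [Ux Vx]; split; [exact: UV|exact: VV].
Qed.

Lemma open_subgroup_closed U : open_subgroup U -> closed U.
Proof.
move=> [oU [U1 UM UV]]; rewrite -[U]setCK; apply: open_closedC.
rewrite openE => x /= nUx; rewrite /interior.
have : open ((fun y => x^-1 * y) @^-1` U).
  by apply: open_comp oU => z _; exact: mulgl_continuous.
rewrite openE => /(_ x); rewrite /= mulVg => /(_ U1); apply: filterS => y /= Uy.
move=> /UV Uy'; apply: nUx; have /UV := UM _ _ Uy Uy'.
by rewrite mulgK invgK.
Qed.

End OpenSubgroups.

Lemma open_setI_preim (S T : topologicalType) (f : S -> T) (A : set S)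
    (B : set T) :
  open A -> {within A, continuous f} -> open B -> open (A `&` f @^-1` B).
Proof.
move=> oA; rewrite continuous_open_subspace// => fc oB.
rewrite openE => x [Ax Bfx]; apply: filterI; first by move: x Ax {Bfx}; rewrite openE in oA.
by apply: fc; [rewrite inE|move: oB; rewrite openE; apply].
Qed.

Lemma lift_continuous (S X Y : topologicalType) (f : X -> Y) (U : set X)
    (V : set S) (b : S -> X) (c : S -> Y) :
  hausdorff_space Y -> compact U -> {within U, continuous f} -> set_inj U f ->
  open V -> {within V, continuous c} -> (forall y, V y -> U (b y)) ->
  (forall y, V y -> f (b y) = c y) -> {within V, continuous b}.
Proof.
move=> hY cU fc fi oV cc VU fb.
have cc' := cc; rewrite continuous_open_subspace// in cc.
rewrite continuous_open_subspace//.
move=> y; rewrite inE => Vy N; rewrite nbhsE => -[O [oO Oby] ON].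
have clW : closed (f @` (U `&` ~` O)).
  apply: compact_closed => //; apply: continuous_compact.
    exact: continuous_subspaceW fc.
  by apply: compact_closedI => //; exact: open_closedC.
pose W := ~` (f @` (U `&` ~` O)).
have oW : open W by exact: closed_openC.
have : nbhs y (V `&` c @^-1` W).
  apply: open_nbhs_nbhs; split; first exact: open_setI_preim.
  split => //= -[x [Ux nOx] fx]; apply: nOx; suff -> : x = b y by [].
  by apply: fi; rewrite ?inE ?fx ?fb//; exact: VU.
apply: filterS => z [Vz Wz]; apply: ON; apply: contrapT => nO; apply: Wz.
by exists (b z); [split => //; exact: VU|exact: fb].
Qed.

Section VirtualAutomorphisms.
Variable H : profiniteGroupType.
Implicit Types (a b : virtual_aut H) (U V : set H) (x y g : H).

Lemma va1 a : a 1 = 1.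
Proof.
have [_ [a1 _ _]] := va_dom_os a.
by apply: (@mulgI _ (a 1)); rewrite mulg1 -vaM// mulg1.
Qed.

Lemma vaV a x : va_dom a x -> a x^-1 = (a x)^-1.
Proof.
have [_ [_ _ aV]] := va_dom_os a.
move=> ax; apply: (@mulgI _ (a x)).
by rewrite mulgV -vaM ?mulgV ?va1//; exact: aV.
Qed.

Lemma va_preim_os a U :
  open_subgroup U -> open_subgroup (va_dom a `&` a @^-1` U).
Proof.
move=> [oU [U1 UM UV]]; have [oa [a1 aM aV]] := va_dom_os a.
split; first by apply: open_setI_preim => //; exact: va_continuous.
split => /=; first by rewrite /preimage/= va1.
  by move=> x y [ax Ux] [ay Uy]; split; [exact: aM|rewrite /preimage/= vaM//; exact: UM].
by move=> x [ax Ux]; split; [exact: aV|rewrite /preimage/= vaV//; exact: UV].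
Qed.

Definition vinv_fun a y : H := xget 1 [set x | va_dom a x /\ a x = y].

Lemma vinv_funP a y : (a @` va_dom a) y ->
  va_dom a (vinv_fun a y) /\ a (vinv_fun a y) = y.
Proof. by move=> [x ax <-]; rewrite /vinv_fun; case: xgetP => [z _ //|/(_ x)[]]. Qed.

Lemma vinv_funK a x : va_dom a x -> vinv_fun a (a x) = x.
Proof.
move=> ax; have [|da ea] := @vinv_funP a (a x); first by exists x.
by apply: (va_inj _ _ ea); rewrite inE.
Qed.

Lemma vinv_fun_continuous a :
  {within a @` va_dom a, continuous (vinv_fun a)}.
Proof.
apply: (@lift_continuous H H H a (va_dom a) _ _ id).
- exact: profinite_hausdorff.
- apply: subclosed_compact (@profinite_compact H) _ => //.
  by apply: open_subgroup_closed; exact: va_dom_os.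
- exact: va_continuous.
- exact: va_inj.
- by have [] := va_cod_os a.
- by apply: continuous_subspaceT => x; exact: cvg_id.
- by move=> y /vinv_funP[].
- by move=> y /vinv_funP[].
Qed.

Lemma va_image_os a U :
  open_subgroup U -> U `<=` va_dom a -> open_subgroup (a @` U).
Proof.
move=> [oU [U1 UM UV]] Ua; split.
  have [ocod _] := va_cod_os a.
  have -> : a @` U = a @` va_dom a `&` vinv_fun a @^-1` U.
    apply/seteqP; split => [_ [x Ux <-]|y [[x ax <-]]] /=.
      by split; [exists x => //; exact: Ua|rewrite /preimage/= vinv_funK//; exact: Ua].
    by rewrite /preimage/= vinv_funK// => Ux; exists x.
  apply: open_setI_preim => //; exact: vinv_fun_continuous.
split; first by exists 1 => //; exact: va1.
  move=> _ _ [x Ux <-] [y Uy <-]; exists (x * y); first exact: UM.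
  by rewrite vaM//; exact: Ua.
by move=> _ [x Ux <-]; exists x^-1; [exact: UV|rewrite vaV//; exact: Ua].
Qed.

Lemma vcomp_cod a b :
  open_subgroup ((a \o b) @` (va_dom b `&` b @^-1` va_dom a)).
Proof.
rewrite -image_comp; apply: va_image_os; last by move=> _ [x [_ ax] <-].
by apply: va_image_os; [exact/va_preim_os/va_dom_os|move=> x []].
Qed.

Lemma vcomp_continuous a b :
  {within va_dom b `&` b @^-1` va_dom a, continuous (a \o b)}.
Proof.
have [oa _] := va_dom_os a; have [ob _] := va_dom_os b.
have [oab _] := va_preim_os b (va_dom_os a).
have ca := @va_continuous _ a; have cb := @va_continuous _ b.
rewrite continuous_open_subspace// in ca.
rewrite continuous_open_subspace// in cb.
rewrite continuous_open_subspace//.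
move=> x; rewrite inE => -[bx abx]; apply: continuous_comp.
  by apply: cb; rewrite inE.
by apply: ca; rewrite inE.
Qed.

Lemma vcomp_inj a b :
  set_inj (va_dom b `&` b @^-1` va_dom a) (a \o b).
Proof.
move=> x y; rewrite !inE => -[bx abx] [by_ aby] e.
by apply: (@va_inj _ b); rewrite ?inE//; apply: (@va_inj _ a); rewrite ?inE.
Qed.

Lemma vcompM a b x y : (va_dom b `&` b @^-1` va_dom a) x ->
  (va_dom b `&` b @^-1` va_dom a) y ->
  (a \o b) (x * y) = (a \o b) x * (a \o b) y.
Proof. by move=> [bx ax] [by_ ay] /=; rewrite !vaM. Qed.

Definition vcomp a b : virtual_aut H :=
  VirtualAut (va_preim_os b (va_dom_os a)) (vcomp_cod a b)
    (@vcomp_continuous a b) (@vcomp_inj a b) (@vcompM a b).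

Lemma vinv_cod a : open_subgroup (vinv_fun a @` (a @` va_dom a)).
Proof.
have -> : vinv_fun a @` (a @` va_dom a) = va_dom a; last exact: va_dom_os.
apply/seteqP; split => [_ [_ [x ax <-] <-]|x ax]; first by rewrite vinv_funK.
by exists (a x); [exists x|rewrite vinv_funK].
Qed.

Lemma vinv_inj a : set_inj (a @` va_dom a) (vinv_fun a).
Proof.
move=> x y; rewrite !inE => /vinv_funP[_ ex] /vinv_funP[_ ey] e.
by rewrite -ex -ey e.
Qed.

Lemma vinvM a x y : (a @` va_dom a) x -> (a @` va_dom a) y ->
  vinv_fun a (x * y) = vinv_fun a x * vinv_fun a y.
Proof.
have [_ [_ aM _]] := va_dom_os a.
by move=> [x' ax <-] [y' ay <-]; rewrite -vaM// !vinv_funK//; exact: aM.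
Qed.

Definition vinv a : virtual_aut H :=
  VirtualAut (va_cod_os a) (vinv_cod a) (@vinv_fun_continuous a)
    (@vinv_inj a) (@vinvM a).

Lemma vconj_cod g : open_subgroup ((fun x => g * x * g^-1) @` [set: H]).
Proof.
have -> : (fun x => g * x * g^-1) @` [set: H] = setT; last exact: open_subgroupT.
apply/seteqP; split => // x _; exists (g^-1 * x * g) => //.
by rewrite !mulgA mulgK mulgV mul1g.
Qed.

Lemma vconj_continuous g :
  {within [set: H], continuous (fun x => g * x * g^-1)}.
Proof. by apply: continuous_subspaceT => x; exact: conj_continuous. Qed.

Lemma vconj_inj g : set_inj [set: H] (fun x => g * x * g^-1).
Proof. by move=> x y _ _ /mulIg/mulgI. Qed.

Lemma vconjM g x y : [set: H] x -> [set: H] y ->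
  g * (x * y) * g^-1 = (g * x * g^-1) * (g * y * g^-1).
Proof. by move=> _ _; rewrite !mulgA mulgVK. Qed.

Definition vconj g : virtual_aut H :=
  VirtualAut (open_subgroupT H) (vconj_cod g) (@vconj_continuous g)
    (@vconj_inj g) (@vconjM g).

Lemma va_equiv_refl a : va_equiv a a.
Proof. by exists (va_dom a); split=> //; exact: va_dom_os. Qed.

Lemma va_equiv_sym a b : va_equiv a b -> va_equiv b a.
Proof. by move=> [U [oU Uab e]]; exists U; split=> //; [rewrite setIC|move=> x /e]. Qed.

Lemma va_equiv_trans b a c : va_equiv a b -> va_equiv b c -> va_equiv a c.
Proof.
move=> [U [oU Uab eU]] [V [oV Vbc eV]]; exists (U `&` V); split.
- exact: open_subgroupI.
- by move=> x [/Uab[? _] /Vbc[_ ?]].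
- by move=> x [Ux Vx]; rewrite eU// eV.
Qed.

Definition va_equivb : rel (virtual_aut H) := fun a b => `[< va_equiv a b >].

Lemma va_equivb_rel : equiv_class_of va_equivb.
Proof.
apply: EquivClass.
- by move=> a; apply/asboolP; exact: va_equiv_refl.
- by move=> a b; apply/asbool_equiv_eq; split; exact: va_equiv_sym.
- move=> b a c /asboolP ab /asboolP bc; apply/asboolP.
  exact: va_equiv_trans bc.
Qed.

Canonical va_equiv_equiv := EquivRelPack va_equivb_rel.

Lemma vcomp_equiv a a' b b' : va_equiv a a' -> va_equiv b b' ->
  va_equiv (vcomp a b) (vcomp a' b').
Proof.
move=> [U [oU Uaa eU]] [V [oV Vbb eV]].
exists (V `&` (va_dom b `&` b @^-1` U)); split.
- by apply: open_subgroupI => //; exact: va_preim_os.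
- move=> x [/[dup] Vx /Vbb[bx b'x] [_ Ubx]] /=; have [abx a'bx] := Uaa _ Ubx.
  by split; split=> //; rewrite /preimage/= -eV.
- by move=> x [Vx [bx Ubx]] /=; rewrite eU// eV.
Qed.

Lemma vinv_equiv a b : va_equiv a b -> va_equiv (vinv a) (vinv b).
Proof.
move=> [U [oU Uab eU]]; exists (a @` U); split.
- by apply: va_image_os => // x /Uab[].
- move=> _ [x Ux <-]; have [ax bx] := Uab _ Ux.
  by split; exists x => //; rewrite -eU.
- move=> _ [x Ux <-] /=; have [ax bx] := Uab _ Ux.
  by rewrite vinv_funK// eU// vinv_funK.
Qed.

End VirtualAutomorphisms.

Definition commensurator (H : profiniteGroupType) : Type :=
  {eq_quot (va_equiv_equiv H)}.

Section Commensurator.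
Variable H : profiniteGroupType.
Implicit Types (U V : set H).

HB.instance Definition _ := Choice.copy (commensurator H) {eq_quot (va_equiv_equiv H)}.

Definition comm_class (a : virtual_aut H) : commensurator H :=
  \pi_({eq_quot (va_equiv_equiv H)}) a.

Definition comm_repr (a : commensurator H) : virtual_aut H :=
  repr (a : {eq_quot (va_equiv_equiv H)}).

Lemma comm_reprK a : comm_class (comm_repr a) = a.
Proof. exact: reprK. Qed.

Lemma comm_classP (a b : virtual_aut H) :
  comm_class a = comm_class b <-> va_equiv a b.
Proof.
split=> [/eqP|ab]; first by rewrite eqmodE => /asboolP.
by apply/eqP; rewrite eqmodE; apply/asboolP.
Qed.

Lemma comm_repr_class a : va_equiv (comm_repr (comm_class a)) a.
Proof. by apply/comm_classP; rewrite comm_reprK. Qed.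

Definition comm_one : commensurator H := comm_class (vconj 1).
Definition comm_mul (a b : commensurator H) : commensurator H :=
  comm_class (vcomp (comm_repr a) (comm_repr b)).
Definition comm_inv (a : commensurator H) : commensurator H := comm_class (vinv (comm_repr a)).

Lemma comm_mulE a b :
  comm_mul (comm_class a) (comm_class b) = comm_class (vcomp a b).
Proof. by apply/comm_classP/vcomp_equiv; exact: comm_repr_class. Qed.

Lemma comm_invE a : comm_inv (comm_class a) = comm_class (vinv a).
Proof. by apply/comm_classP/vinv_equiv; exact: comm_repr_class. Qed.

Lemma comm_classW (P : commensurator H -> Prop) :
  (forall a, P (comm_class a)) -> forall a, P a.
Proof. by move=> h a; rewrite -(comm_reprK a). Qed.

Lemma comm_mulA : associative comm_mul.
Proof.
elim/comm_classW=> a; elim/comm_classW=> b; elim/comm_classW=> c.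
rewrite !comm_mulE; apply/comm_classP.
exists (va_dom (vcomp a (vcomp b c))); split => //; first exact: va_dom_os.
by move=> x /= [[cx bcx] abcx].
Qed.

Lemma comm_mul1 : left_id comm_one comm_mul.
Proof.
elim/comm_classW=> a; rewrite comm_mulE; apply/comm_classP.
exists (va_dom a); split => //; first exact: va_dom_os.
by move=> x ax /=; rewrite mul1g invg1 mulg1.
Qed.

Lemma comm_mulr1 : right_id comm_one comm_mul.
Proof.
elim/comm_classW=> a; rewrite comm_mulE; apply/comm_classP.
exists (va_dom a); split; first exact: va_dom_os.
  by move=> x ax /=; rewrite /preimage/= mul1g invg1 mulg1.
by move=> x ax /=; rewrite mul1g invg1 mulg1.
Qed.

Lemma comm_mulV : left_inverse comm_one comm_inv comm_mul.
Proof.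
elim/comm_classW=> a; rewrite comm_invE comm_mulE; apply/comm_classP.
exists (va_dom a); split; first exact: va_dom_os.
  by move=> x ax /=; split=> //; split=> //; exists x.
by move=> x ax /=; rewrite vinv_funK// mul1g invg1 mulg1.
Qed.

Lemma comm_mulrV : right_inverse comm_one comm_inv comm_mul.
Proof.
elim/comm_classW=> a; rewrite comm_invE comm_mulE; apply/comm_classP.
exists (a @` va_dom a); split; first exact: va_cod_os.
  by move=> x ax /=; split=> //; split=> //; have [] := vinv_funP ax.
move=> x ax /=; have [_ ->] := vinv_funP ax.
by rewrite mul1g invg1 mulg1.
Qed.

HB.instance Definition _ := isGroup.Build (commensurator H)
  comm_mulA comm_mul1 comm_mulr1 comm_mulV comm_mulrV.

Lemma comm_classM (a b : virtual_aut H) :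
  comm_class a * comm_class b = comm_class (vcomp a b).
Proof. exact: comm_mulE. Qed.

(* Conjugation by [u] and its restriction to an open subgroup containing [u] are
   equivalent, so the map [U -> commensurator H] is the restriction of [iotaH] to [U]. *)
Definition iotaH (u : H) : commensurator H := comm_class (vconj u).

Lemma iotaHM : {morph iotaH : u v / u * v}.
Proof.
move=> u v; rewrite comm_classM; apply/comm_classP.
exists setT; split=> //; first exact: open_subgroupT.
by move=> x _ /=; rewrite invgM !mulgA.
Qed.

Lemma iotaH1 : iotaH 1 = 1. Proof. by []. Qed.

Lemma iotaHV u : iotaH u^-1 = (iotaH u)^-1.
Proof. by apply/esym/mulg1_eq; rewrite -iotaHM mulgV. Qed.

Lemma iotaH_conj (a : virtual_aut H) u : va_dom a u ->
  comm_class a * iotaH u = iotaH (a u) * comm_class a.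
Proof.
move=> au; rewrite !comm_classM; apply/comm_classP.
have [oa [a1 aM aV]] := va_dom_os a.
have auV := aV _ au.
exists (va_dom a); split; first exact: va_dom_os.
- move=> x ax /=; split; split => //; rewrite /preimage/=.
  by apply: (aM) => //; exact: aM.
- move=> x ax /=; rewrite vaM ?vaM ?vaV//; exact: aM.
Qed.

(* The neighbourhoods of [a] are the sets containing [a * iotaH @` U] for some
   open subgroup [U]; [comm_nbhs1] and the topological group instance below
   show that this is the strong topology. *)
Definition comm_open (A : set (commensurator H)) : Prop :=
  forall a, A a ->
    exists2 U, open_subgroup U & forall u, U u -> A (a * iotaH u).

Lemma comm_openT : comm_open setT.
Proof. by move=> a _; exists setT => //; exact: open_subgroupT. Qed.

Lemma comm_openI : setI_closed comm_open.
Proof.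
move=> A B oA oB a [Aa Ba]; have [U oU UA] := oA _ Aa; have [V oV VB] := oB _ Ba.
exists (U `&` V); first exact: open_subgroupI.
by move=> u [Uu Vu]; split; [exact: UA|exact: VB].
Qed.

Lemma comm_open_bigU (I : Type) (f : I -> set (commensurator H)) :
  (forall i, comm_open (f i)) -> comm_open (\bigcup_i f i).
Proof.
move=> fo a [i _ fia]; have [U oU Uf] := fo i _ fia.
by exists U => // u Uu; exists i => //; exact: Uf.
Qed.

HB.instance Definition _ := isOpenTopological.Build (commensurator H)
  comm_openT comm_openI comm_open_bigU.

Lemma comm_nbhsP (a : commensurator H) (A : set (commensurator H)) :
  nbhs a A <->
  exists2 U, open_subgroup U & forall u, U u -> A (a * iotaH u).
Proof.
rewrite nbhsE; split=> [[B [oB Ba] BA]|[U oU UA]].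
  have [U oU UB] := (oB : comm_open B) _ Ba.
  by exists U => // u /UB/BA.
have [_ [U1 UM UV]] := oU.
exists [set a * iotaH u | u in U]; last by move=> _ [u Uu <-]; exact: UA.
split; last by exists 1 => //; rewrite iotaH1 mulg1.
move=> _ [u Uu <-]; exists U => // v Uv; exists (u * v); first exact: UM.
by rewrite iotaHM mulgA.
Qed.

Lemma comm_mul_continuous :
  continuous (fun xy : commensurator H * commensurator H => xy.1 * xy.2).
Proof.
move=> [a b] A /= /comm_nbhsP[U oU UA]; rewrite nbhs_simpl/=.
pose b' := vinv (comm_repr b).
have oV := va_preim_os b' oU; have [_ [_ UM _]] := oU.
exists ([set a * iotaH v | v in va_dom b' `&` b' @^-1` U],
        [set b * iotaH u | u in U]) => /=.
  split; apply/comm_nbhsP.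
    by exists (va_dom b' `&` b' @^-1` U) => // v Vv; exists v.
  by exists U => // u Uu; exists u.
move=> [_ _] /= [[v [b'v Ub'v] <-] [u Uu <-]].
have e : comm_class b' * iotaH v = iotaH (b' v) * comm_class b'.
  exact: iotaH_conj.
have eb : comm_class b' = b^-1 by rewrite -comm_invE comm_reprK.
suff -> : a * iotaH v * (b * iotaH u) = a * b * iotaH (b' v * u).
  by apply: UA; exact: UM.
rewrite iotaHM -!mulgA; congr (_ * _); rewrite !mulgA; congr (_ * _).
by apply: (@mulgI _ b^-1); rewrite !mulgA mulVg mul1g -eb e -mulgA eb mulVg mulg1.
Qed.

Lemma comm_inv_continuous : continuous (fun x : commensurator H => x^-1).
Proof.
move=> a A /= /comm_nbhsP[U oU UA]; rewrite nbhs_simpl/=.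
pose a' := comm_repr a; have [_ [_ _ UV]] := oU.
apply/comm_nbhsP; exists (va_dom a' `&` a' @^-1` U); first exact: va_preim_os.
move=> v [a'v Ua'v] /=.
suff -> : (a * iotaH v)^-1 = a^-1 * iotaH (a' v)^-1 by apply: UA; exact: UV.
have := iotaH_conj a'v; rewrite comm_reprK => ->.
by rewrite invgM iotaHV.
Qed.

HB.instance Definition _ := isTopologicalGroup.Build (commensurator H)
  comm_mul_continuous comm_inv_continuous.

Lemma comm_nbhs1 (A : set (commensurator H)) :
  nbhs (1 : commensurator H) A <-> exists2 U, open_subgroup U & iotaH @` U `<=` A.
Proof.
rewrite comm_nbhsP; split=> -[U oU UA]; exists U => //.
  by move=> _ [u Uu <-]; rewrite -[iotaH u]mul1g; exact: UA.
by move=> u Uu; rewrite mul1g; apply: UA; exists u.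
Qed.

Lemma iotaH_open U : open_subgroup U -> open (iotaH @` U).
Proof.
move=> oU; have [_ [_ UM _]] := oU.
move=> _ [u Uu <-]; exists U => // v Uv.
by exists (u * v); [exact: UM|rewrite iotaHM].
Qed.

End Commensurator.

Section Eta.
Variables (H G : profiniteGroupType) (i : open_mono H G).
Implicit Types (g : G) (h x y : H).

Lemma open_mono1 : i 1 = 1.
Proof. by apply: (@mulgI _ (i 1)); rewrite -open_monoM !mulg1. Qed.

Lemma open_monoV h : i h^-1 = (i h)^-1.
Proof. by apply/esym/mulg1_eq; rewrite -open_monoM mulgV open_mono1. Qed.

Definition eta_dom g : set H := [set h | range i (g * i h * g^-1)].

Definition eta_fun g h : H := xget 1 [set k | i k = g * i h * g^-1].

Lemma eta_funE g h : eta_dom g h -> i (eta_fun g h) = g * i h * g^-1.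
Proof. by move=> [k _ ik]; rewrite /eta_fun; case: xgetP => [//|/(_ k)]. Qed.

Lemma conjgMl g (x y : G) :
  g * (x * y) * g^-1 = (g * x * g^-1) * (g * y * g^-1).
Proof. by rewrite !mulgA mulgVK. Qed.

Lemma conj_mono_continuous g : continuous (fun h => g * i h * g^-1).
Proof.
move=> h; apply: (@continuous_comp _ _ _ i (fun x : G => g * x * g^-1)).
  exact: open_mono_continuous.
exact: conj_continuous.
Qed.

Lemma eta_dom_os g : open_subgroup (eta_dom g).
Proof.
split.
  apply: (@open_comp _ _ (fun h => g * i h * g^-1) (range i)).
    by move=> z _; exact: conj_mono_continuous.
  exact: open_mono_open.
split.
- by exists 1 => //; rewrite open_mono1 mulg1 mulgV.
- move=> x y [x' _ ex] [y' _ ey]; exists (x' * y') => //.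
  by rewrite !open_monoM conjgMl ex ey.
- move=> x [x' _ ex]; exists x'^-1 => //.
  by rewrite !open_monoV ex !invgM invgK mulgA.
Qed.

Lemma eta_cod g : eta_fun g @` eta_dom g = eta_dom g^-1.
Proof.
apply/seteqP; split=> [_ [x gx <-]|y [x _ ex]].
  exists x => //; rewrite eta_funE//.
  by rewrite invgK !mulgA mulVg mul1g mulgVK.
have e : g * i x * g^-1 = i y.
  by rewrite ex invgK !mulgA mulgV mul1g mulgK.
have gx : eta_dom g x by rewrite /eta_dom/= e; exists y.
by exists x => //; apply: (@open_mono_inj _ _ i); rewrite eta_funE.
Qed.

Lemma eta_cod_os g : open_subgroup (eta_fun g @` eta_dom g).
Proof. by rewrite eta_cod; exact: eta_dom_os. Qed.

Lemma eta_continuous g : {within eta_dom g, continuous (eta_fun g)}.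
Proof.
apply: (@lift_continuous H H G i setT _ _ (fun h => g * i h * g^-1)).
- exact: profinite_hausdorff.
- exact: profinite_compact.
- by apply: continuous_subspaceT; exact: open_mono_continuous.
- by move=> x y _ _; exact: open_mono_inj.
- by have [] := eta_dom_os g.
- by apply: continuous_subspaceT; exact: conj_mono_continuous.
- by [].
- by move=> y; exact: eta_funE.
Qed.

Lemma eta_inj g : set_inj (eta_dom g) (eta_fun g).
Proof.
move=> x y; rewrite !inE => gx gy /(congr1 i).
by rewrite !eta_funE// => /mulIg/mulgI/open_mono_inj.
Qed.

Lemma eta_funM g x y : eta_dom g x -> eta_dom g y ->
  eta_fun g (x * y) = eta_fun g x * eta_fun g y.
Proof.
move=> gx gy; have [_ [_ gM _]] := eta_dom_os g.
apply: (@open_mono_inj _ _ i).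
by rewrite open_monoM !eta_funE// ?open_monoM ?conjgMl//; exact: gM.
Qed.

Definition eta_va g : virtual_aut H :=
  VirtualAut (eta_dom_os g) (eta_cod_os g) (@eta_continuous g)
    (@eta_inj g) (@eta_funM g).

(* The domain of [eta_va g] is the largest one on which conjugation by [g]
   can be transported through [i]; [etaM] and [eta_iota] are the properties
   that characterize [eta]. *)
Definition eta g : commensurator H := comm_class (eta_va g).

Lemma etaM : {morph eta : g g' / g * g'}.
Proof.
move=> g g'; rewrite comm_classM; apply/comm_classP.
have e x : va_dom (vcomp (eta_va g) (eta_va g')) x ->
    i (eta_fun g (eta_fun g' x)) = g * g' * i x * (g * g')^-1.
  by move=> [/= g'x gx]; rewrite !eta_funE// invgM !mulgA.
have d x : va_dom (vcomp (eta_va g) (eta_va g')) x -> eta_dom (g * g') x.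
  by move=> dx; exists (eta_fun g (eta_fun g' x)) => //; exact: e.
exists (va_dom (vcomp (eta_va g) (eta_va g'))); split.
- exact: va_dom_os.
- by move=> x dx; split => //; exact: d.
- move=> x dx /=; apply: (@open_mono_inj _ _ i).
  by rewrite e// eta_funE//; exact: d.
Qed.

Lemma eta_iota h : eta (i h) = iotaH h.
Proof.
have e x : i (h * x * h^-1) = i h * i x * (i h)^-1.
  by rewrite !open_monoM open_monoV.
have d x : eta_dom (i h) x by exists (h * x * h^-1).
apply/comm_classP; exists (eta_dom (i h)); split.
- exact: eta_dom_os.
- by move=> x dx.
- by move=> x dx /=; apply: (@open_mono_inj _ _ i); rewrite e eta_funE.
Qed.

End Eta.

(* Main.v *)
(** A completion [K] is itself an open overgroup of [H], so it acts on germs of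
    [H] through [eta], compatibly with [G1] and [G2]; hence both [eta_i (G_i)]
    lie in the image of [K], which is compact and, being an open subgroup,
    closed.  Conversely, the subgroup generated by the [eta_i (G_i)] contains
    the open subgroup [iotaH H], so it is open and closed; if it is precompact
    it is compact, and it serves as the completion, with the [eta_i] as the two
    embeddings.  They are injective because an element acting trivially on a
    germ centralizes an open subgroup.  That the commensurator separates points
    by clopen sets needs the open subgroups of [H] to intersect trivially: this
    intersection is connected. *)

From HB Require Import structures.
Require Import Defs.
From mathcomp Require Import all_boot.
From mathcomp Require Import all_classical topology.

Set Implicit Arguments.
Unset Strict Implicit.
Unset Printing Implicit Defensive.

Local Open Scope classical_set_scope.
Local Open Scope group_scope.

(** * Neighbourhoods and subgroups in topological groups *)

Lemma zero_dimensional_hausdorff (T : topologicalType) :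
  zero_dimensional T -> hausdorff_space T.
Proof.
move=> zT; rewrite open_hausdorff => x y /zT[U [[oU cU] Ux nUy]].
exists (U, ~` U); first by rewrite !inE.
by split=> //=; [exact: closed_openC|rewrite setICr].
Qed.

Lemma mulgl_preimage_nbhs (G : topologicalGroupType) (g : G) (A : set G) :
  nbhs 1 A -> nbhs g ((fun y => g^-1 * y) @^-1` A).
Proof. by move=> A1; apply: (@mulgl_continuous G g^-1 g); rewrite mulVg. Qed.

(** Left translation by [x] in [A] carries a neighbourhood of [1] inside [A] to a neighbourhood of
    [x] inside [A]. *)
Lemma nbhs1_open_subgroup (G : topologicalGroupType) (A : set G) :
  is_subgroup A -> nbhs 1 A -> open_subgroup A.
Proof.
move=> sA nA; split=> //; have [_ AM _] := sA.
rewrite openE => x Ax; move: (mulgl_preimage_nbhs x nA); apply: filterS => y Ay.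
by rewrite -[y](mulVKg x); apply: AM.
Qed.

Lemma generated_subgroup (G : groupType) (A : set G) :
  is_subgroup (generated A).
Proof.
split; first by move=> B [[]].
  move=> x y Ax Ay B sB; have [[_ BM _] _] := sB.
  by apply: BM; [exact: Ax|exact: Ay].
by move=> x Ax B sB; have [[_ _ Bi] _] := sB; apply: Bi; exact: Ax.
Qed.

(** * Separation of points by open subgroups of a profinite group *)

Section OpenSubgroupsProfinite.
Variable G : profiniteGroupType.
Implicit Types (V O : set G) (x g : G).

(* [V] is stable under right translation by all elements of a neighbourhood of
   [1]; the elements [g] such that [g] and [g^-1] stabilize [V] form the
   subgroup. *)
Lemma clopen_open_subgroup V : clopen V -> V 1 ->
  exists2 U, open_subgroup U & U `<=` V.
Proof.
move=> [oV cV] V1.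
have stab : \forall g \near (1 : G), V `<=` [set v | V (v * g)].
  (* Compactness of [V] turns continuity of multiplication at each [(v, 1)] into one neighbourhood
     of [1] valid for all [v]. *)
  have /compact_near_coveringP : compact V.
    by apply: (subclosed_compact cV (@profinite_compact G)) => x.
  apply => v Vv.
  have vV : nbhs (v * 1) V by rewrite mulg1; exact: open_nbhs_nbhs.
  exact: (@mulg_continuous G (v, 1)) vV.
exists [set g | V `<=` [set v | V (v * g)] /\ V `<=` [set v | V (v * g^-1)]].
  apply: nbhs1_open_subgroup.
    split=> /=.
    - by split=> v Vv /=; rewrite ?invg1 mulg1.
    - move=> x y [xV xVi] [yV yVi]; split=> v Vv /=.
        by rewrite mulgA; apply/yV/xV.
      by rewrite invgM mulgA; apply/xVi/yVi.
    - by move=> x [xV xVi]; rewrite invgK.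
  apply: filterI => //.
  by have := @invg_continuous G 1; rewrite /continuous_at invg1 => /(_ _ stab).
by move=> g [/(_ _ V1)]; rewrite /= mul1g.
Qed.

Definition open_core : set G := \bigcap_(U in @open_subgroup G) U.

(** Otherwise the traces of the open subgroups on the complement of [O] generate a proper filter. By
    compactness it has a cluster point there, which lies in every open subgroup since these are
    closed. *)
Lemma open_core_sub_open O : open O -> open_core `<=` O ->
  exists2 U, open_subgroup U & U `<=` O.
Proof.
move=> oO coreO; apply: contrapT => nO.
pose F := filter_from (@open_subgroup G) (fun U => U `&` ~` O).
have FF : ProperFilter F.
  apply: filter_from_proper.
    apply: filter_from_filter; first by exists setT; exact: open_subgroupT.
    move=> U V oU oV; exists (U `&` V); first exact: open_subgroupI.
    by move=> x [[Ux Vx] nOx].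
  move=> U oU; apply: contrapT => nU; apply: nO; exists U => // x Ux.
  by apply: contrapT => nOx; apply: nU; exists x.
have cO : compact (~` O).
  apply: (subclosed_compact _ (@profinite_compact G)) => //.
  exact: open_closedC.
have [|p [nOp clp]] := cO F FF.
  by exists setT; [exact: open_subgroupT|move=> x []].
apply/nOp/coreO => U oU; apply: contrapT => nUp.
have FU : F U by exists U => // x [].
have nnU : nbhs p (~` U).
  apply: open_nbhs_nbhs; split=> //; apply: closed_openC.
  exact: open_subgroup_closed.
by have [q []] := clp _ _ FU nnU.
Qed.

Lemma open_core_closed : closed open_core.
Proof. by apply: closed_bigI => U; exact: open_subgroup_closed. Qed.

Lemma open_core1 : open_core 1.
Proof. by move=> U [_ []]. Qed.

Lemma open_core_connected : connected open_core.
Proof.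
(* [O] separates [B] from the rest of the core; by compactness some open
   subgroup [W] lies in [O] together with the other side, so that [W `&` O] is
   clopen and contains an open subgroup, hence the core. *)
have step (B C D : set G) : open C -> closed D -> B = open_core `&` C ->
    B = open_core `&` D -> B 1 -> open_core `<=` B.
  move=> oC cD BC BD B1.
  have cB : closed B by rewrite BD; apply: closedI cD; exact: open_core_closed.
  have oE : open (~` (open_core `&` ~` C)).
    apply: closed_openC; apply: closedI; first exact: open_core_closed.
    exact: open_closedC.
  (* By normality [B] has a neighbourhood [A] whose closure misses the rest of the core. *)
  have [A nA clA] : filter_from (set_nbhs B) closure (~` (open_core `&` ~` C)).
    apply: (compact_normal (@profinite_hausdorff G)) => //.
      exact: profinite_compact.
    apply/set_nbhsP; eexists; split; [exact: oE| |by []].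
    by move=> x; rewrite BC => -[_ Cx] [_].
  have [O [oO BO OA]] := (iffLR (set_nbhsP _ _) nA).
  have OclA : O `<=` closure A := subset_trans OA (@subset_closure _ A).
  have [||W oW WO] := @open_core_sub_open (O `|` ~` closure A).
  - by apply: openU => //; apply/closed_openC/closed_closure.
  - move=> x cx; have [Cx|nCx] := pselect (C x).
      by left; apply: BO; rewrite BC.
    by right=> /clA; apply.
  have [||M oM MW] := @clopen_open_subgroup (W `&` O).
  - split; first by apply: openI => //; have [] := oW.
    (* [W] meets [closure A] only inside [O], so cutting [W] with [O] or with [closure A] gives the
       same set, which is therefore also closed. *)
    have -> : W `&` O = W `&` closure A.
      apply/seteqP; split=> x [Wx Ox]; split=> //; first exact: OclA.
      by have [] := WO _ Wx.
    by apply: closedI; [exact: open_subgroup_closed|exact: closed_closure].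
  - by split; [have [_ []] := oW|exact: BO].
  - move=> x cx; have /MW[_ /OclA/clA nx] := cx _ oM.
    by rewrite BC; split=> //; apply: contrapT => nCx; apply: nx.
move=> B [b Bb] [C oC BC] [D cD BD].
have [B1|nB1] := pselect (B 1).
  apply/seteqP; split; first by rewrite BC => x [].
  exact: step oC cD BC BD B1.
(* When [1] lies outside [B], the complement of [B] in the core is the side containing [1]; [step]
   makes it the whole core, contradicting the point [b]. *)
have BCD : open_core `&` ~` D = open_core `&` ~` C.
  apply/seteqP; split=> x [cx nx]; split=> // x'; apply: nx.
    by have [] : (open_core `&` D) x by rewrite -BD BC.
  by have [] : (open_core `&` C) x by rewrite -BC BD.
have := step _ _ _ (closed_openC cD) (open_closedC oC) erefl BCD.
have b1 : (open_core `&` ~` D) 1.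
  split; first exact: open_core1.
  by move=> D1; apply: nB1; rewrite BD; split=> //; exact: open_core1.
have [cb Db] : (open_core `&` D) b by rewrite -BD.
by move=> /(_ b1 b cb)[_].
Qed.

(** The open core is connected and contains [1], so total disconnectedness reduces it to [1]. *)
Lemma open_subgroup_separates g : g <> 1 ->
  exists2 U, open_subgroup U & ~ U g.
Proof.
move=> g1; apply: contrapT => nU; apply: g1.
have : connected_component [set: G] 1 g.
  apply: (connected_component_max open_core1 _ open_core_connected) => //.
  by move=> U oU; apply: contrapT => nUg; apply: nU; exists U.
by rewrite profinite_disconnected.
Qed.

End OpenSubgroupsProfinite.

(** * Virtual centers, open monomorphisms and the maps [eta] *)

Lemma virtual_centerP (G : topologicalGroupType) (U : set G) (g : G) :
  open_subgroup U -> U `<=` centralizer1 g -> virtual_center G g.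
Proof.
move=> [oU [U1 _ _]] Ug; have [] // := @nbhs1_open_subgroup G (centralizer1 g).
  rewrite /centralizer1; split=> /= [|x y xg yg|x xg].
  - by rewrite mul1g mulg1.
  - by rewrite -mulgA yg !mulgA xg.
  - by apply: (@mulgI _ x); rewrite mulVKg mulgA xg mulgK.
by apply: filterS Ug _; exact: open_nbhs_nbhs.
Qed.

Section OpenMono.
Variables (H G : profiniteGroupType) (i : open_mono H G).

(** By injectivity the image of [U] is the range of [i] minus the image of the complement of [U],
    which is compact and hence closed. *)
Lemma open_mono_image_open (U : set H) : open U -> open (i @` U).
Proof.
move=> oU; have -> : i @` U = range i `&` ~` (i @` (~` U)).
  apply/seteqP; split=> [_ [x Ux <-]|_ [[x _ <-] nx]].
    split; first by exists x.
    by move=> [y nUy /open_mono_inj yx]; apply: nUy; rewrite yx.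
  by exists x => //; apply: contrapT => nUx; apply: nx; exists x.
apply: openI; first exact: open_mono_open.
apply: closed_openC; apply: compact_closed; first exact: profinite_hausdorff.
apply: continuous_compact.
  by apply: continuous_subspaceT; exact: open_mono_continuous.
apply: (subclosed_compact _ (@profinite_compact H)) => //.
exact: open_closedC.
Qed.

Lemma open_mono_image_subgroup (U : set H) :
  open_subgroup U -> open_subgroup (i @` U).
Proof.
move=> [oU [U1 UM UV]]; split; first exact: open_mono_image_open.
split; first by exists 1 => //; exact: open_mono1.
  move=> _ _ [x Ux <-] [y Uy <-]; exists (x * y); first exact: UM.
  exact: open_monoM.
by move=> _ [x Ux <-]; exists x^-1; [exact: UV|exact: open_monoV].
Qed.

Lemma eta1 : eta i 1 = 1.
Proof. by apply: (@mulgI _ (eta i 1)); rewrite -etaM !mulg1. Qed.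

Lemma etaV g : eta i g^-1 = (eta i g)^-1.
Proof. by apply/esym/mulg1_eq; rewrite -etaM mulgV eta1. Qed.

(** Close to [g], elements have the form [g * i u] with [u] in [U], and [eta i] sends them to
    [eta i g * iotaH u]. *)
Lemma eta_cts : continuous (eta i).
Proof.
move=> g A /comm_nbhsP[U oU UA].
have iU : nbhs 1 (i @` U).
  have [oiU [iU1 _ _]] := open_mono_image_subgroup oU.
  exact: open_nbhs_nbhs.
rewrite nbhs_simpl /=; move: (mulgl_preimage_nbhs g iU).
apply: filterS => y [u Uu iu].
rewrite /preimage/= -[y](mulVKg g) -iu etaM eta_iota; exact: UA.
Qed.

Lemma range_eta_open_subgroup : open_subgroup (range (eta i)).
Proof.
apply: nbhs1_open_subgroup.
  split; first by exists 1; rewrite ?eta1.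
    by move=> _ _ [x _ <-] [y _ <-]; exists (x * y); rewrite ?etaM.
  by move=> _ [x _ <-]; exists x^-1; rewrite ?etaV.
apply/comm_nbhs1; exists setT; first exact: open_subgroupT.
by move=> _ [h _ <-]; exists (i h); rewrite ?eta_iota.
Qed.

Lemma eta_injective : virtual_center G = [set 1] -> injective (eta i).
Proof.
move=> VZ; suff K g : eta i g = 1 -> g = 1.
  move=> x y xy; apply: (@mulIg _ y^-1); rewrite mulgV; apply: K.
  by rewrite etaM etaV xy mulgV.
move=> /comm_classP[U [oU Udom Ug]].
suff : virtual_center G g by rewrite VZ.
(* Acting trivially on [U] means that [g] commutes with every [i x], [x] in [U]. *)
apply: virtual_centerP (open_mono_image_subgroup oU) _ => _ [x Ux <-].
have [/= gx _] := Udom _ Ux; have := eta_funE gx.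
have /= -> := Ug _ Ux; rewrite mul1g invg1 mulg1 /centralizer1/= => e.
by rewrite {1}e mulgVK.
Qed.

End OpenMono.

(** Since [j] intertwines conjugation by [g] and by [j g], transporting through [i] or through [k]
    gives the same map on [eta_dom i g]. *)
Lemma eta_comp (H G K : profiniteGroupType) (i : open_mono H G)
    (j : open_mono G K) (k : open_mono H K) :
  k =1 j \o i -> forall g, eta k (j g) = eta i g.
Proof.
move=> kE g.
have e x : eta_dom i g x -> j g * k x * (j g)^-1 = k (eta_fun i g x).
  by move=> gx; rewrite !kE /= eta_funE// !open_monoM open_monoV.
have d x : eta_dom i g x -> eta_dom k (j g) x.
  by move=> gx; exists (eta_fun i g x) => //; rewrite e.
apply/comm_classP; exists (eta_dom i g); split.
- exact: eta_dom_os.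
- by move=> x gx; split => //=; exact: d.
- move=> x gx /=; apply: (@open_mono_inj _ _ k).
  by rewrite eta_funE; [exact: e|exact: d].
Qed.

Lemma open_mono_comp_range_open (H G K : profiniteGroupType) (i : open_mono H G)
  (j : open_mono G K) : open (range (j \o i)).
Proof.
rewrite -(image_comp i j); apply: open_mono_image_open.
exact: open_mono_open.
Qed.

Lemma open_mono_compM (H G K : profiniteGroupType) (i : open_mono H G)
  (j : open_mono G K) : {morph j \o i : x y / x * y}.
Proof. by move=> x y; rewrite /= !open_monoM. Qed.

Lemma open_mono_comp_continuous (H G K : profiniteGroupType)
  (i : open_mono H G) (j : open_mono G K) : continuous (j \o i).
Proof. by move=> x; apply: continuous_comp; exact: open_mono_continuous. Qed.

Definition open_mono_comp (H G K : profiniteGroupType) (j : open_mono G K)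
    (i : open_mono H G) : open_mono H K :=
  OpenMono (@open_mono_compM H G K i j) (@open_mono_comp_continuous H G K i j)
    (inj_comp (@open_mono_inj _ _ j) (@open_mono_inj _ _ i))
    (@open_mono_comp_range_open H G K i j).

(** * Separation of points in the commensurator *)

Lemma commensurator_zero_dimensional (H : profiniteGroupType) :
  injective (@iotaH H) -> zero_dimensional (commensurator H).
Proof.
move=> iI x y /eqP xy.
(* The separating clopen set is the left coset by [x] of the image of [U]; this choice of [U] makes
   it miss [y]. *)
have [U oU nU] : exists2 U, open_subgroup U & ~ (@iotaH H @` U) (x^-1 * y).
  have [[h _ hxy]|nh] := pselect (range (@iotaH H) (x^-1 * y)); last first.
    by exists setT; [exact: open_subgroupT|].
  have [|U oU nUh] := @open_subgroup_separates H h.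
    move=> h1; apply: xy; apply: (@mulgI _ x^-1).
    by rewrite -hxy h1 iotaH1 mulVg.
  by exists U => // -[u Uu]; rewrite -hxy => /iI uh; apply: nUh; rewrite -uh.
have oiU := iotaH_open oU; have [_ [U1 UM UV]] := oU.
have sU : is_subgroup (@iotaH H @` U).
  split; first by exists 1.
    move=> _ _ [u Uu <-] [v Uv <-]; exists (u * v); first exact: UM.
    exact: iotaHM.
  by move=> _ [u Uu <-]; exists u^-1; [exact: UV|exact: iotaHV].
exists ((fun z => x^-1 * z) @^-1` (@iotaH H @` U)); split=> //.
  apply: preimage_clopen; last exact: mulgl_continuous.
  by split=> //; exact: open_subgroup_closed.
by exists 1 => //; rewrite mulVg.
Qed.

(** * Compact subgroups as profinite groups *)

Section SubgroupType.
Variables (T : topologicalGroupType) (L : set T) (sL : is_subgroup L).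

(* The unused proof argument lets the group structure, which depends on it, be
   inferred from the type. *)
Definition subgroup_type (_ : is_subgroup L) : Type := set_type L.
Local Notation S := (subgroup_type sL).

HB.instance Definition _ := Topological.copy S (set_type L).

Let LV (x : S) : L (val x). Proof. exact: set_mem (valP x). Qed.

Definition subgroup_in (x : T) (Lx : L x) : S :=
  exist (fun x => x \in L) x (mem_set Lx).

Let one : S := subgroup_in (let: And3 L1 _ _ := sL in L1).
Let mul (x y : S) : S :=
  subgroup_in (let: And3 _ LM _ := sL in LM _ _ (LV x) (LV y)).
Let inv (x : S) : S :=
  subgroup_in (let: And3 _ _ Li := sL in Li _ (LV x)).

Let mulA : associative mul.
Proof. by move=> x y z; apply: val_inj; exact: mulgA. Qed.
Let mul1 : left_id one mul.
Proof. by move=> x; apply: val_inj; exact: mul1g. Qed.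
Let mulr1 : right_id one mul.
Proof. by move=> x; apply: val_inj; exact: mulg1. Qed.
Let mulV : left_inverse one inv mul.
Proof. by move=> x; apply: val_inj; exact: mulVg. Qed.
Let mulrV : right_inverse one inv mul.
Proof. by move=> x; apply: val_inj; exact: mulgV. Qed.

HB.instance Definition _ := isGroup.Build S mulA mul1 mulr1 mulV mulrV.

Lemma subgroup_val_continuous : continuous (val : S -> T).
Proof. exact: initial_continuous. Qed.

Lemma subgroup_continuous (X : topologicalType) (f : X -> S) :
  continuous (val \o f) -> continuous f.
Proof. exact: continuous_comp_initial. Qed.

Let mul_continuous : continuous (fun xy : S * S => xy.1 * xy.2).
Proof.
have c1 : continuous (fun p : S * S => val p.1).
  move=> p; apply: (@continuous_comp _ _ _ (@fst S S) (val : S -> T)).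
    exact: cvg_fst.
  exact: subgroup_val_continuous.
have c2 : continuous (fun p : S * S => val p.2).
  move=> p; apply: (@continuous_comp _ _ _ (@snd S S) (val : S -> T)).
    exact: cvg_snd.
  exact: subgroup_val_continuous.
apply: subgroup_continuous => p.
apply: (@continuous2_cvg _ T T T _ _ (fun p : S * S => val p.1)
  (fun p : S * S => val p.2) *%g (val p.1) (val p.2)).
- exact: (@mulg_continuous T (val p.1, val p.2)).
- exact: c1.
- exact: c2.
Qed.

Let inv_continuous : continuous (fun x : S => x^-1).
Proof.
apply: subgroup_continuous => x.
apply: (@continuous_comp S T T (val : S -> T) (fun x : T => x^-1)).
  exact: subgroup_val_continuous.
exact: invg_continuous.
Qed.

HB.instance Definition _ :=
  isTopologicalGroup.Build S mul_continuous inv_continuous.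

Lemma subgroup_zero_dimensional : zero_dimensional T -> zero_dimensional S.
Proof.
move=> zT x y /eqP xy; have /zT[U [cU Ux nUy]] : val x != val y.
  by apply/eqP => /val_inj.
exists (val @^-1` U : set S); split=> //.
by apply: preimage_clopen => //; exact: subgroup_val_continuous.
Qed.

(** A filter on [S] is pushed forward along [val]; its cluster point in [L] lifts back because open
    sets of [S] are traces of open sets of [T]. *)
Lemma subgroup_compact : compact L -> compact [set: S].
Proof.
move=> cL F FF _; have [|p [Lp clp]] := cL ((val : S -> T) @ F) _.
  by apply: (@filterS _ F _ setT) => [x _|]; [exact: LV|exact: filterT].
exists (subgroup_in Lp); split=> // A B FA.
rewrite nbhsE => -[_ [[W oW <-] Wp] WB].
have [||_ [[a Aa <-] Wa]] := clp ((val : S -> T) @` A) W.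
- by apply: (@filterS _ F _ A) => [x Ax|//]; exists x.
- exact: open_nbhs_nbhs.
- by exists a; split=> //; exact: WB.
Qed.

(** Zero-dimensionality passes to the subgroup and yields both the Hausdorff property and total
    disconnectedness. *)
Definition subgroup_profinite (cL : compact L) (zT : zero_dimensional T) :
    profiniteGroupType :=
  HB.pack S (isProfinite.Build S (subgroup_compact cL)
    (zero_dimensional_hausdorff (subgroup_zero_dimensional zT))
    (zero_dimension_totally_disconnected (subgroup_zero_dimensional zT))).

End SubgroupType.

(** * The maps [eta] as open embeddings into a compact subgroup *)

Section EtaCorestriction.
Variables (H G : profiniteGroupType) (i : open_mono H G).
Variables (L : set (commensurator H)) (sL : is_subgroup L) (cL : compact L).
Hypotheses (zC : zero_dimensional (commensurator H)).
Hypotheses (VZ : virtual_center G = [set 1]) (iL : range (eta i) `<=` L).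
Let K := subgroup_profinite sL cL zC.

Let jL g : L (eta i g). Proof. by apply: iL; exists g. Qed.
Let j (g : G) : K := subgroup_in sL (jL g).

Let jM : {morph j : x y / x * y}.
Proof. by move=> x y; apply: val_inj; exact: etaM. Qed.

Let j_continuous : continuous j.
Proof. by apply: (@subgroup_continuous _ _ sL); exact: eta_cts. Qed.

Let j_inj : injective j.
Proof. by move=> x y /(congr1 val) /(eta_injective VZ). Qed.

Let j_open : open (range j).
Proof.
(* The range is the trace on [K] of an open subgroup of the commensurator. *)
have -> : range j = (val : K -> commensurator H) @^-1` range (eta i).
  apply/seteqP; split=> [_ [g _ <-]|x [g _ gx]]; first by exists g.
  by exists g => //; apply: val_inj.
apply: open_comp; first by move=> x _; exact: (@subgroup_val_continuous _ _ sL).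
by have [] := range_eta_open_subgroup i.
Qed.

Definition eta_mono : open_mono G K := OpenMono jM j_continuous j_inj j_open.

End EtaCorestriction.

Theorem proposition5p3 (G1 G2 H : profiniteGroupType)
    (c : commensuration G1 G2 H)
    (VZ1 : virtual_center G1 = [set 1])
    (VZ2 : virtual_center G2 = [set 1]) :
  admits_completion c <->
  precompact (generated (range (eta (iota1 c)) `|` range (eta (iota2 c)))).
Proof.
set A := _ `|` _; split=> [[[K j1 j2 E]]|pA].
  pose k := open_mono_comp j1 (iota1 c).
  have k2 : k =1 j2 \o iota2 c by move=> h; rewrite -E.
  have ok := range_eta_open_subgroup k.
  (* Precompactness asks for a compact closed set containing the generated subgroup; [eta_comp] puts
     the generators in this one. *)
  exists (range (eta k)).
    apply: smallest_sub; first by have [] := ok.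
    move=> _ [] [g _ <-]; [exists (j1 g) => //|exists (j2 g) => //].
      exact: (@eta_comp _ _ _ _ j1 k).
    exact: (@eta_comp _ _ _ _ j2 k).
  split; last exact: open_subgroup_closed.
  apply: continuous_compact (@profinite_compact K).
  by apply: continuous_subspaceT; exact: eta_cts.
have sA := generated_subgroup A.
have A1 : range (eta (iota1 c)) `<=` generated A.
  by apply: subset_trans (@sub_gen_smallest _ _ _); exact: subsetUl.
have A2 : range (eta (iota2 c)) `<=` generated A.
  by apply: subset_trans (@sub_gen_smallest _ _ _); exact: subsetUr.
have oA : open_subgroup (generated A).
  apply: nbhs1_open_subgroup sA _; apply: filterS A1 _; apply: open_nbhs_nbhs.
  by have [? []] := range_eta_open_subgroup (iota1 c).
have cA : compact (generated A).
  by rewrite -precompact_closed//; exact: open_subgroup_closed.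
have zC : zero_dimensional (commensurator H).
  (* [iotaH] is [eta (iota1 c)] after [iota1 c], a composite of injective maps. *)
  apply: commensurator_zero_dimensional => x y.
  by rewrite -!(eta_iota (iota1 c)) => /(eta_injective VZ1)/open_mono_inj.
apply: (inhabits (@Completion _ _ _ c _ (eta_mono sA cA zC VZ1 A1)
  (eta_mono sA cA zC VZ2 A2) _)).
(* After inclusion into the commensurator both composites equal [iotaH]. *)
by apply/funext => h; apply: val_inj; rewrite /= !eta_iota.
Qed.
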